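(* Let $X\in\mathbb{R}^{n\times p}$ be a fixed matrix whose columns satisfy $\|X_j\|_2\le 1$ for all $j=1,\ldots,p$, let $\beta^0\in\mathbb{R}^p$ be fixed, and let $Y=X\beta^0+\epsilon$ where $\epsilon=(\epsilon_1,\ldots,\epsilon_n)^T$ has i.i.d. $\mathcal{N}(0,1/n)$ entries. Let $0<\alpha<1$ and $0<\alpha_1<1$ be fixed, $\lambda_0:=\sqrt{2\log(2p/\alpha)/n}$, and suppose $\eta\lambda>\lambda_0$ for some $0\le\eta<1$. Let $\hat\beta$ be the noisy Lasso and $\beta^*$ the noiseless Lasso with tuning parameter $\lambda$ (see context). Let $\Sigma_0$ be a fixed symmetric positive semidefinite $p\times p$ matrix (an approximation of $\hat\Sigma=X^TX$), and suppose that $$\xi:=\|\hat\Sigma-\Sigma_0\|_\infty\,\|\beta^*-\beta^0\|_1<\lambda(1-\eta).$$ Then with probability at least $1-\alpha-\alpha_1$, $$\|X(\hat\beta-\beta^* )\|_2\le\frac{\Lambda_{\max}^{1/2}(\Sigma_0)\left(\|X(\beta^*-\beta^0)\|_2^2+\xi\|\beta^*-\beta^0\|_1\right)^{1/2}}{\sqrt n\,\left(\lambda(1-\eta)-\xi\right)}+\sqrt{\frac{2\log(1/\alpha_1)}{n}}.$$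
   Context: The noisy Lasso is $\hat\beta:=\arg\min_{\beta\in\mathbb{R}^p}\{\|Y-X\beta\|_2^2+2\lambda\|\beta\|_1\}$ and the noiseless Lasso is $\beta^*:=\arg\min_{\beta\in\mathbb{R}^p}\{\|X(\beta-\beta^0)\|_2^2+2\lambda\|\beta\|_1\}$ (non-random). $\hat\Sigma:=X^TX$ is the Gram matrix, $\|\hat\Sigma-\Sigma_0\|_\infty:=\max_{j,k}|\hat\Sigma_{j,k}-\Sigma_{0,j,k}|$, and $\Lambda_{\max}(A)$ is the largest eigenvalue of a symmetric matrix $A$. *)

(* Defs.v *)
From HB Require Import structures.
From mathcomp Require Import all_boot all_order all_algebra.
From mathcomp Require Import all_classical all_reals all_analysis.

Set Implicit Arguments.
Unset Strict Implicit.
Unset Printing Implicit Defensive.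

Import Order.TTheory GRing.Theory Num.Theory.
Import numFieldNormedType.Exports.

Local Open Scope classical_set_scope.
Local Open Scope ring_scope.

(* The norm `|x| that MathComp-Analysis puts on matrices is the entrywise
   maximum, [mx_norm]; the l2 and l1 norms have to be defined. *)
Definition l2norm (R : realType) (m : nat) (x : 'cV[R]_m) : R :=
  Num.sqrt (\sum_(i < m) x i 0 ^+ 2).

Definition l1norm (R : realType) (m : nat) (x : 'cV[R]_m) : R :=
  \sum_(i < m) `|x i 0|.

Definition argmin (R : realType) (V : Type) (f : V -> R) : set V :=
  [set b | forall b', f b <= f b'].

Definition noisy_lasso (R : realType) (n p : nat) (X : 'M[R]_(n, p))
    (Y : 'cV[R]_n) (lambda : R) : set 'cV[R]_p :=
  argmin (fun b => l2norm (Y - X *m b) ^+ 2 + 2 * lambda * l1norm b).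

Definition noiseless_lasso (R : realType) (n p : nat) (X : 'M[R]_(n, p))
    (beta0 : 'cV[R]_p) (lambda : R) : set 'cV[R]_p :=
  argmin (fun b => l2norm (X *m (b - beta0)) ^+ 2 + 2 * lambda * l1norm b).

Definition gram (R : realType) (n p : nat) (X : 'M[R]_(n, p)) : 'M[R]_p :=
  X^T *m X.

Definition psdmx (R : realType) (p : nat) (A : 'M[R]_p) : Prop :=
  A^T = A /\ forall u : 'cV[R]_p, 0 <= (u^T *m A *m u) 0 0.

(* The set of eigenvalues of a matrix is finite, and it is nonempty if the
   matrix is symmetric and 0 < p; then the supremum is a maximum. *)
Definition Lambda_max (R : realType) (p : nat) (A : 'M[R]_p) : R :=
  sup [set a : R | eigenvalue A a].

(* The product rule is asked of every finite subfamily [J]. *)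
Definition mutually_independent (d : measure_display) (T : measurableType d)
    (R : realType) (P : probability T R) (I : finType)
    (X : I -> {RV P >-> R}) : Prop :=
  forall (J : {set I}) (B : I -> set R), (forall i, measurable (B i)) ->
    P (\bigcap_(i in [set` J]) (X i @^-1` B i)) =
    (\prod_(i in J) P (X i @^-1` B i))%E.

(* [normal_prob m s] takes the standard deviation [s], not the variance, as
   its second parameter.  The two set functions are compared on measurable
   sets because their values elsewhere are meaningless. *)
Definition has_normal_law (d : measure_display) (T : measurableType d)
    (R : realType) (P : probability T R) (X : {RV P >-> R})
    (mean variance : R) : Prop :=
  forall B : set R, measurable B ->
    distribution P X B = normal_prob mean (Num.sqrt variance) B.

(* Main.v *)
(** Put r = X^T X (betastar - beta0), h = betastar - beta0, and let S be the set
    of j with |r_j| >= lambda (1 - eta).  Coordinates outside S vanish in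
    betastar, and the first-order conditions of the two Lassos give, with
    d = betahat - betastar,
      |X d|^2 <= eps . X d - eta lambda sum_(j notin S) |d_j|.
    Split eps = Q eps + (1 - Q) eps, with Q the orthogonal projection onto the
    span of the columns X_j, j in S.  If |X_j . (1 - Q) eps| <= eta lambda for
    all j, the second part is absorbed by the sum, hence |X d| <= |Q eps|.  The
    condition fails with probability at most alpha (union bound), and
    |Q eps| > sqrt (#|S| / n) + sqrt (2 log (1 / alpha1) / n) with probability
    at most alpha1 (chi-square tail).  Finally |r_j| <= |(Sigma0 h)_j| + xi, so
      #|S| (lambda (1 - eta) - xi)^2 <= |Sigma0 h|^2
        <= Lambda_max(Sigma0) h . Sigma0 h. *)

Require Import Defs.
From HB Require Import structures.
From mathcomp Require Import all_boot all_order all_algebra.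
From mathcomp Require Import all_classical all_reals all_analysis.
From mathcomp Require Import measurable_realfun ring lra.

Set Implicit Arguments.
Unset Strict Implicit.
Unset Printing Implicit Defensive.

Import Order.TTheory GRing.Theory Num.Theory.
Import numFieldNormedType.Exports.

Local Open Scope classical_set_scope.
Local Open Scope ring_scope.

(** * Inner product, positive semidefinite matrices and their largest eigenvalue *)

Definition dot (R : realType) (m : nat) (u v : 'cV[R]_m) : R :=
  \sum_(i < m) u i 0 * v i 0.

Lemma dotE (R : realType) (m : nat) (u v : 'cV[R]_m) :
  dot u v = (u^T *m v) 0 0.
Proof. by rewrite mxE; apply: eq_bigr => i _; rewrite mxE. Qed.

Lemma dotC (R : realType) (m : nat) (u v : 'cV[R]_m) : dot u v = dot v u.
Proof. by apply: eq_bigr => i _; rewrite mulrC. Qed.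

Lemma dotDl (R : realType) (m : nat) (u v w : 'cV[R]_m) :
  dot (u + v) w = dot u w + dot v w.
Proof. by rewrite -big_split; apply: eq_bigr => i _; rewrite mxE mulrDl. Qed.

Lemma dotZl (R : realType) (m : nat) a (u w : 'cV[R]_m) :
  dot (a *: u) w = a * dot u w.
Proof. by rewrite mulr_sumr; apply: eq_bigr => i _; rewrite mxE mulrA. Qed.

Lemma dotNl (R : realType) (m : nat) (u w : 'cV[R]_m) :
  dot (- u) w = - dot u w.
Proof. by rewrite -scaleN1r dotZl mulN1r. Qed.

Lemma dotBl (R : realType) (m : nat) (u v w : 'cV[R]_m) :
  dot (u - v) w = dot u w - dot v w.
Proof. by rewrite dotDl dotNl. Qed.

Lemma dotDr (R : realType) (m : nat) (u v w : 'cV[R]_m) :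
  dot w (u + v) = dot w u + dot w v.
Proof. by rewrite !(dotC w) dotDl. Qed.

Lemma dotZr (R : realType) (m : nat) a (u w : 'cV[R]_m) :
  dot w (a *: u) = a * dot w u.
Proof. by rewrite !(dotC w) dotZl. Qed.

Lemma dotNr (R : realType) (m : nat) (u w : 'cV[R]_m) :
  dot w (- u) = - dot w u.
Proof. by rewrite !(dotC w) dotNl. Qed.

Lemma dotBr (R : realType) (m : nat) (u v w : 'cV[R]_m) :
  dot w (u - v) = dot w u - dot w v.
Proof. by rewrite !(dotC w) dotBl. Qed.

Lemma dot0l (R : realType) (m : nat) (w : 'cV[R]_m) : dot 0 w = 0.
Proof. by rewrite -(scale0r w) dotZl mul0r. Qed.

Lemma dot0r (R : realType) (m : nat) (w : 'cV[R]_m) : dot w 0 = 0.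
Proof. by rewrite dotC dot0l. Qed.

Lemma dot_suml (R : realType) (m : nat) (I : Type) (s : seq I)
    (F : I -> 'cV[R]_m) (w : 'cV[R]_m) :
  dot (\sum_(i <- s) F i) w = \sum_(i <- s) dot (F i) w.
Proof.
by elim: s => [|i s IH]; rewrite ?big_nil ?dot0l// !big_cons dotDl IH.
Qed.

Lemma dot_mulmxr (R : realType) (m k : nat) (A : 'M[R]_(m, k)) u v :
  dot u (A *m v) = dot (A^T *m u) v.
Proof. by rewrite !dotE trmx_mul trmxK mulmxA. Qed.

Lemma dot_ge0 (R : realType) (m : nat) (u : 'cV[R]_m) : 0 <= dot u u.
Proof. by apply: sumr_ge0 => i _; rewrite -expr2 sqr_ge0. Qed.

Lemma dot_eq0 (R : realType) (m : nat) (u : 'cV[R]_m) :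
  (dot u u == 0) = (u == 0).
Proof.
apply/eqP/eqP => [/psumr_eq0P u0|->]; last exact: dot0l.
apply/colP => i; rewrite mxE; apply/eqP; rewrite -[_ == _]orbb -mulf_eq0.
by rewrite u0// => j _; rewrite -expr2 sqr_ge0.
Qed.

Lemma l2norm_ge0 (R : realType) (m : nat) (u : 'cV[R]_m) : 0 <= l2norm u.
Proof. exact: sqrtr_ge0. Qed.

Lemma sqr_l2norm (R : realType) (m : nat) (u : 'cV[R]_m) :
  l2norm u ^+ 2 = dot u u.
Proof.
rewrite sqr_sqrtr; first by apply: eq_bigr => i _; rewrite expr2.
by apply: sumr_ge0 => i _; rewrite sqr_ge0.
Qed.

(** If c > 0, the minimizer t = -b/c gives the claim. If c = 0, the form is affine in t and a
    nonzero b would let it reach -1. *)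
Lemma discriminant_le (R : realType) (a b c : R) : 0 <= c ->
  (forall t, 0 <= a + 2 * t * b + t ^+ 2 * c) -> b ^+ 2 <= a * c.
Proof.
rewrite le_eqVlt => /predU1P[<-|c0] h.
  rewrite mulr0; have [->|b0] := eqVneq b 0; first by rewrite expr0n.
  have := h (- (a + 1) / (2 * b)).
  rewrite mulr0 addr0 [X in a + X](_ : _ = - (a + 1)); last by field.
  by rewrite opprD addrA subrr sub0r ler0N1.
have := h (- b / c).
rewrite [X in 0 <= X](_ : _ = (a * c - b ^+ 2) / c); last by field; lra.
by rewrite pmulr_lge0 ?invr_gt0// subr_ge0.
Qed.

Lemma psd_dot_ge0 (R : realType) (p : nat) (A : 'M[R]_p) u :
  psdmx A -> 0 <= dot u (A *m u).
Proof. by case=> _ /(_ u); rewrite dotE mulmxA. Qed.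

Lemma psd_cauchy_schwarz (R : realType) (p : nat) (A : 'M[R]_p) u v :
  psdmx A -> dot u (A *m v) ^+ 2 <= dot u (A *m u) * dot v (A *m v).
Proof.
move=> Apsd; apply: discriminant_le => [|t]; first exact: psd_dot_ge0.
have := psd_dot_ge0 (u + t *: v) Apsd.
rewrite mulmxDr -scalemxAr !dotDr !dotDl !dotZr !dotZl.
rewrite [dot v (A *m u)]dot_mulmxr Apsd.1 [dot (A *m v) u]dotC.
by move=> h; apply: le_trans h _; rewrite le_eqVlt; apply/orP; left; apply/eqP; ring.
Qed.

Lemma psdmx1 (R : realType) (p : nat) : @psdmx R p 1%:M.
Proof.
by split=> [|u]; rewrite ?trmx1// mulmx1 -dotE dot_ge0.
Qed.

Lemma dot_le_l2norm (R : realType) (m : nat) (u v : 'cV[R]_m) :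
  dot u v <= l2norm u * l2norm v.
Proof.
apply: le_trans (ler_norm _) _.
rewrite -[leRHS]ger0_norm ?mulr_ge0 ?l2norm_ge0// -ler_sqr ?nnegrE//.
rewrite !real_normK ?num_real// exprMn !sqr_l2norm.
by have := psd_cauchy_schwarz u v (psdmx1 R m); rewrite !mul1mx.
Qed.

Lemma l2norm_le_of_dot (R : realType) (m : nat) (u v : 'cV[R]_m) :
  dot v v <= dot u v -> l2norm v <= l2norm u.
Proof.
move=> h; have [->|n0] := eqVneq (l2norm v) 0; first exact: l2norm_ge0.
have n1 : 0 < l2norm v by rewrite lt0r n0 l2norm_ge0.
by rewrite -(ler_pM2r n1) -expr2 sqr_l2norm (le_trans h)// dot_le_l2norm.
Qed.

Lemma quadratic_form_bounded (R : realType) (p : nat) (A : 'M[R]_p) :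
  exists2 C, 0 < C & forall v, dot v (A *m v) <= C * dot v v.
Proof.
(* The summand 1 keeps the constant positive even for A = 0, so that it can be inverted later. *)
exists (1 + \sum_i \sum_j `|A i j|) => [|v].
  by rewrite ltr_pwDl// sumr_ge0// => i _; rewrite sumr_ge0.
rewrite mulrDl mul1r; apply: (@le_trans _ _ (\sum_i \sum_j `|A i j| * dot v v)).
  rewrite /dot; under eq_bigr do rewrite mxE mulr_sumr.
  apply: ler_sum => i _; apply: ler_sum => j _.
  apply: le_trans (ler_norm _) _; rewrite mulrCA normrM ler_wpM2l//.
  apply: (@le_trans _ _ ((v i 0 ^+ 2 + v j 0 ^+ 2) / 2)).
    rewrite normrM -(real_normK (num_real (v i 0))).
    rewrite -(real_normK (num_real (v j 0))).
    by have := sqr_ge0 (`|v i 0| - `|v j 0|); nra.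
  have hk k : v k 0 ^+ 2 <= dot v v.
    rewrite /dot (bigD1 k)//= expr2 lerDl sumr_ge0// => l _.
    by rewrite -expr2 sqr_ge0.
  by have := hk i; have := hk j; rewrite /dot; lra.
rewrite ler_wpDl ?dot_ge0// mulr_suml.
by apply: ler_sum => i _; rewrite mulr_suml.
Qed.

(** Cauchy-Schwarz for the form A at v and Av gives |Av|^4 <= (v . Av)(Av . AAv) <= (v . Av) mu
    |Av|^2. Dividing by |Av|^2 replaces a spectral decomposition. *)
Lemma psd_sqr_mulmx_le (R : realType) (p : nat) (A : 'M[R]_p) (mu : R) :
  psdmx A -> (forall v, dot v (A *m v) <= mu * dot v v) ->
  forall v, dot (A *m v) (A *m v) <= mu * dot v (A *m v).
Proof.
move=> Apsd hmu v; have [->|Av0] := eqVneq (A *m v) 0.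
  by rewrite !dot0r mulr0.
have w0 : 0 < dot (A *m v) (A *m v) by rewrite lt0r dot_eq0 Av0 dot_ge0.
rewrite -(ler_pM2r w0).
have := psd_cauchy_schwarz v (A *m v) Apsd.
rewrite [in X in X -> _]dot_mulmxr Apsd.1 => h.
rewrite -expr2 (le_trans h)// -mulrA mulrCA ler_wpM2l ?psd_dot_ge0//.
Qed.

Definition rayleigh_values (R : realType) (p : nat) (A : 'M[R]_p) : set R :=
  [set dot v (A *m v) | v in [set v | dot v v = 1]].

Lemma has_sup_rayleigh (R : realType) (p : nat) (A : 'M[R]_p) :
  (0 < p)%N -> has_sup (rayleigh_values A).
Proof.
case: p A => // p A _; split.
  exists (dot (delta_mx 0 0) (A *m delta_mx 0 0)), (delta_mx 0 0) => //=.
  rewrite /dot big_ord_recl big1 ?addr0 => [|i _]; first by rewrite mxE mulr1.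
  by rewrite mxE mul0r.
have [C _ hC] := quadratic_form_bounded A.
by exists C => _ /= [v v1 <-]; rewrite (le_trans (hC v))// v1 mulr1.
Qed.

Lemma rayleigh_le (R : realType) (p : nat) (A : 'M[R]_p) v : (0 < p)%N ->
  dot v (A *m v) <= sup (rayleigh_values A) * dot v v.
Proof.
move=> p0; have [->|v0] := eqVneq v 0; first by rewrite !dot0l mulr0.
have vv0 : 0 < dot v v by rewrite lt0r dot_eq0 v0 dot_ge0.
have n0 : l2norm v != 0.
  by apply: contraTneq vv0 => n0; rewrite -sqr_l2norm n0 expr0n ltxx.
rewrite -ler_pdivrMr//; apply: (ub_le_sup (has_sup_rayleigh A p0).2).
exists ((l2norm v)^-1 *: v) => /=.
  by rewrite dotZl dotZr -sqr_l2norm; field.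
by rewrite -scalemxAr dotZl dotZr -sqr_l2norm; field.
Qed.

(* If mu - A were invertible, the positive semidefinite form of mu - A would be
   bounded below by a positive multiple of |v|^2, contradicting the choice of
   mu as a supremum; so no compactness of the sphere is needed. *)
Lemma rayleigh_sup_eigenvalue (R : realType) (p : nat) (A : 'M[R]_p) :
  (0 < p)%N -> A^T = A -> eigenvalue A (sup (rayleigh_values A)).
Proof.
move=> p0 Asym; set mu := sup _; pose B := mu%:M - A.
have BE v : dot v (B *m v) = mu * dot v v - dot v (A *m v).
  by rewrite mulmxBl mul_scalar_mx dotBr dotZr.
have Bpsd : psdmx B.
  split=> [|u]; first by rewrite linearB/= tr_scalar_mx Asym.
  by rewrite -mulmxA -dotE BE subr_ge0 rayleigh_le.
have Bnu : B \notin unitmx.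
  apply/negP => Bu.
  have [C C0 hC] := quadratic_form_bounded B.
  have [K K0 hK] := quadratic_form_bounded ((invmx B)^T *m invmx B).
  (* For |v| = 1: 1 = |B^-1 B v|^2 <= K |Bv|^2 <= K C (v . Bv), the last step by
     [psd_sqr_mulmx_le]. *)
  have hv v : dot v v = 1 -> dot v (A *m v) <= mu - (K * C)^-1.
    move=> v1; have Bv : dot v (B *m v) = mu - dot v (A *m v).
      by rewrite BE v1 mulr1.
    rewrite lerBrDl -lerBrDr -Bv -[_^-1]mulr1 ler_pdivrMl ?mulr_gt0//.
    have := hK (B *m v); rewrite -mulmxA mulKmx// dot_mulmxr trmxK mulKmx// v1.
    move=> h; apply: le_trans h _.
    by rewrite -mulrA ler_pM2l// psd_sqr_mulmx_le.
  have : mu <= mu - (K * C)^-1.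
    apply: ge_sup; first by case: (has_sup_rayleigh A p0).
    by move=> _ [v /= v1 <-]; apply: hv.
  by rewrite leNgt ltrBlDr ltrDl invr_gt0 mulr_gt0.
have /det0P[v v0 vB] : \det B == 0.
  by rewrite -[_ == _]negbK -unitfE -unitmxE.
apply/eigenvalueP; exists v => //; apply/esym/eqP.
by rewrite -subr_eq0 -mul_mx_scalar -mulmxBr vB.
Qed.

(** The left side is itself an eigenvalue. It remains to see that the set of eigenvalues is bounded
    above, since otherwise [sup] would say nothing about it. *)
Lemma rayleigh_sup_le_Lambda_max (R : realType) (p : nat) (A : 'M[R]_p) :
  (0 < p)%N -> A^T = A -> sup (rayleigh_values A) <= Lambda_max A.
Proof.
move=> p0 Asym; apply: ub_le_sup; last exact: rayleigh_sup_eigenvalue.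
exists (sup (rayleigh_values A)) => a /= /eigenvalueP[x xA x0].
have hx : 0 < dot x^T x^T by rewrite lt0r dot_eq0 trmx_eq0 x0 dot_ge0.
rewrite -(ler_pM2r hx) -dotZl.
(* [eigenvalue] is about row vectors; by symmetry the transpose is a column eigenvector. *)
have -> : a *: x^T = A *m x^T by rewrite -{1}Asym -trmx_mul xA linearZ.
by rewrite dotC rayleigh_le.
Qed.

Lemma psd_sqr_mulmx_le_Lambda_max (R : realType) (p : nat) (A : 'M[R]_p) v :
  (0 < p)%N -> psdmx A ->
  dot (A *m v) (A *m v) <= Lambda_max A * dot v (A *m v).
Proof.
move=> p0 Apsd; apply: psd_sqr_mulmx_le => // {}v.
apply: le_trans (rayleigh_le _ _ p0) _; rewrite ler_wpM2r ?dot_ge0//.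
exact: rayleigh_sup_le_Lambda_max Apsd.1.
Qed.

Lemma psd_Lambda_max_ge0 (R : realType) (p : nat) (A : 'M[R]_p) :
  (0 < p)%N -> psdmx A -> 0 <= Lambda_max A.
Proof.
move=> p0 Apsd; apply: le_trans (rayleigh_sup_le_Lambda_max p0 Apsd.1).
have [[a [v v1 va]] ub] := has_sup_rayleigh A p0.
apply: (@le_trans _ _ a); first by rewrite -va psd_dot_ge0.
by apply: ub_le_sup => //; exists v.
Qed.

(** * First-order conditions for the Lasso *)

Lemma l1norm_convex (R : realType) (p : nat) (b b' : 'cV[R]_p) (t : R) :
  0 <= t <= 1 ->
  l1norm (b + t *: (b' - b)) <= l1norm b + t * (l1norm b' - l1norm b).
Proof.
move=> /andP[t0 t1]; rewrite /l1norm -sumrB mulr_sumr -big_split/=.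
apply: ler_sum => i _; rewrite !mxE.
rewrite (_ : _ + _ = (1 - t) * b i 0 + t * b' i 0); last by ring.
apply: le_trans (ler_normD _ _) _.
rewrite !normrM (ger0_norm t0) (@ger0_norm _ (1 - t)) ?subr_ge0//.
by rewrite le_eqVlt; apply/orP; left; apply/eqP; ring.
Qed.

(** Replaces the limit t -> 0: if a > 0, then t = 1 gives a <= b, so t = a / (2 b) is admissible and
    yields a <= a / 2. *)
Lemma le0_of_linear_perturbation (R : realType) (a b : R) :
  (forall t, 0 < t <= 1 -> a <= t * b) -> a <= 0.
Proof.
move=> h; rewrite leNgt; apply/negP => a0.
have b0 : 0 < b by have := h 1; rewrite ltr01 lexx mul1r; lra.
have ab : a <= b by have := h 1; rewrite ltr01 lexx mul1r; apply.
have := h (a / (2 * b)); rewrite divr_gt0 ?mulr_gt0// ler_pdivrMr ?mulr_gt0//.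
rewrite (_ : a / _ * b = a / 2); last by field; lra.
by move/(_ ltac:(lra)); lra.
Qed.

(** Compare the objective at b and at b + t (b' - b). Convexity bounds the l1 part linearly in t,
    the square leaves t^2 |X (b' - b)|^2; divide by t and let t vanish. *)
Lemma lasso_first_order (R : realType) (n p : nat) (X : 'M[R]_(n, p)) y
    (lambda : R) b : 0 <= lambda -> noisy_lasso X y lambda b ->
  forall b', dot (y - X *m b) (X *m (b' - b)) <=
             lambda * (l1norm b' - l1norm b).
Proof.
move=> l0 hb b'; rewrite -subr_le0.
apply: (@le0_of_linear_perturbation _ _
  (dot (X *m (b' - b)) (X *m (b' - b)) / 2)) => t /andP[t0 t1].
have tge0 := ltW t0.
have := hb (b + t *: (b' - b)) => /=; rewrite !sqr_l2norm.
rewrite mulmxDr opprD addrA -scalemxAr.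
move: (y - X *m b) (X *m (b' - b)) => u v; rewrite !dotBl !dotBr !dotZl !dotZr (dotC v u).
have := @l1norm_convex _ _ b b' t; rewrite tge0 t1 => /(_ isT) h1 h2.
rewrite -(ler_pM2l t0).
have h3 : lambda * l1norm (b + t *: (b' - b)) <=
   lambda * (l1norm b + t * (l1norm b' - l1norm b)) by rewrite ler_wpM2l.
lra.
Qed.

(** Both estimators are Lassos, with different responses, so one set of first-order conditions
    serves for both. *)
Lemma noiseless_lassoE (R : realType) (n p : nat) (X : 'M[R]_(n, p)) beta0
    (lambda : R) :
  noiseless_lasso X beta0 lambda = noisy_lasso X (X *m beta0) lambda.
Proof.
rewrite /noisy_lasso /noiseless_lasso; congr argmin; apply/funext => b.
by rewrite -mulmxBr !sqr_l2norm -opprB mulmxN dotNl dotNr opprK.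
Qed.

Lemma l1normZ (R : realType) (p : nat) (a : R) (b : 'cV[R]_p) :
  l1norm (a *: b) = `|a| * l1norm b.
Proof. by rewrite mulr_sumr; apply: eq_bigr => i _; rewrite mxE normrM. Qed.

Lemma dot_delta (R : realType) (p : nat) (r : 'cV[R]_p) j :
  dot r (delta_mx j 0) = r j 0.
Proof.
rewrite /dot (bigD1 j)//= big1 => [|i ij].
  by rewrite [delta_mx _ _ _ _]mxE !eqxx mulr1 addr0.
by rewrite [delta_mx _ _ _ _]mxE (negbTE ij) mulr0.
Qed.

Lemma l1norm_add_delta_le (R : realType) (p : nat) (b : 'cV[R]_p) j (t : R) :
  l1norm (b + t *: delta_mx j 0) <= l1norm b + `|t|.
Proof.
rewrite /l1norm (bigD1 j)//= [in leRHS](bigD1 j)//= [leRHS]addrAC.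
rewrite lerD//; first by rewrite !mxE !eqxx mulr1 ler_normD.
by apply: ler_sum => i ij; rewrite !mxE (negbTE ij) mulr0 addr0.
Qed.

Section lasso.
Variables (R : realType) (n p : nat) (X : 'M[R]_(n, p)) (lambda : R).

Lemma lasso_kkt_le y b j : 0 <= lambda -> noisy_lasso X y lambda b ->
  `|(X^T *m (y - X *m b)) j 0| <= lambda.
Proof.
move=> l0 hb; set r := X^T *m _.
have h t : r j 0 * t <= lambda * `|t|.
  have := lasso_first_order l0 hb (b + t *: delta_mx j 0).
  rewrite [b + _]addrC addrK dot_mulmxr -/r dotZr mulrC.
  rewrite dot_delta => h; apply: le_trans h _; rewrite ler_wpM2l// lerBlDl addrC.
  by rewrite l1norm_add_delta_le.
rewrite ler_norml; have := h 1; have := h (-1).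
by rewrite normrN normr1; lra.
Qed.

(** Each difference of the two sides has a sign by [lasso_kkt_le], and the competitor 0 shows that
    their sum has the opposite sign, so all of them vanish. *)
Lemma lasso_kkt_eq y b j : 0 <= lambda -> noisy_lasso X y lambda b ->
  (X^T *m (y - X *m b)) j 0 * b j 0 = lambda * `|b j 0|.
Proof.
move=> l0 hb; set r := X^T *m _.
have h0 i : 0 <= lambda * `|b i 0| - r i 0 * b i 0.
  rewrite subr_ge0; apply: le_trans (ler_norm _) _; rewrite normrM.
  by rewrite ler_wpM2r// lasso_kkt_le.
have hs : \sum_i (lambda * `|b i 0| - r i 0 * b i 0) = 0.
  apply/eqP; rewrite eq_le sumr_ge0 ?andbT//.
  have := lasso_first_order l0 hb 0.
  rewrite sub0r mulmxN dotNr dot_mulmxr -/r -(scale0r b) l1normZ normr0 mul0r.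
  by rewrite sub0r mulrN lerN2 sumrB -mulr_sumr -/(l1norm b) -/(dot r b) subr_le0.
by apply/esym/eqP; rewrite -subr_eq0 (psumr_eq0P _ hs).
Qed.

(** Each minimizer is the competitor of the other; in the sum of the two inequalities the l1 terms
    cancel. This makes the fitted values depend continuously on the noise, whichever minimizers are
    selected. *)
Lemma lasso_lipschitz y y' b b' : 0 <= lambda ->
  noisy_lasso X y lambda b -> noisy_lasso X y' lambda b' ->
  l2norm (X *m (b - b')) <= l2norm (y - y').
Proof.
move=> l0 hb hb'.
have h := lasso_first_order l0 hb b'; have h' := lasso_first_order l0 hb' b.
have hle : dot (X *m (b - b')) (X *m (b - b')) <= dot (y - y') (X *m (b - b')).
  move: h h'; rewrite -(opprB b b') mulmxN !mulmxBr !dotNr !dotBl !dotBr; lra.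
exact: l2norm_le_of_dot.
Qed.

End lasso.

(** * Comparison of the two Lassos on a fixed noise vector *)

(** A list rather than a projection matrix: its length becomes the number of degrees of freedom, and
    the Gaussian integral below is an induction on it. *)
Definition orthonormal (R : realType) (n : nat) (us : seq 'cV[R]_n) :=
  all (fun u => dot u u == 1) us && pairwise (fun u v => dot u v == 0) us.

Definition proj (R : realType) (n : nat) (us : seq 'cV[R]_n) (x : 'cV[R]_n) :=
  \sum_(u <- us) dot u x *: u.

Lemma dot_projl (R : realType) (n : nat) (us : seq 'cV[R]_n) x y :
  dot (proj us x) y = \sum_(u <- us) dot u x * dot u y.
Proof. by rewrite dot_suml; apply: eq_bigr => u _; rewrite dotZl. Qed.

Lemma dot_proj_comm (R : realType) (n : nat) (us : seq 'cV[R]_n) x y :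
  dot (proj us x) y = dot x (proj us y).
Proof.
by rewrite [RHS]dotC !dot_projl; apply: eq_bigr => u _; rewrite mulrC.
Qed.

Lemma orthonormal_dot_proj (R : realType) (n : nat) (us : seq 'cV[R]_n) x u :
  orthonormal us -> u \in us -> dot u (proj us x) = dot u x.
Proof.
rewrite dotC dot_projl.
elim: us => // v us IH; rewrite /orthonormal/= => /andP[/andP[v1 u1] /andP[uv uu]].
have ho : orthonormal us by rewrite /orthonormal u1.
rewrite in_cons big_cons => /predU1P[->|uin].
  rewrite (eqP v1) mulr1 big_seq big1 ?addr0// => w wus.
  by rewrite dotC [dot w v]dotC (eqP (allP uv _ wus)) mulr0.
by rewrite (eqP (allP uv _ uin)) mulr0 add0r IH.
Qed.

Lemma orthonormal_proj_idem (R : realType) (n : nat) (us : seq 'cV[R]_n) x :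
  orthonormal us -> proj us (proj us x) = proj us x.
Proof.
move=> ho; rewrite [LHS]/proj [RHS]/proj !big_seq.
by apply: eq_bigr => u uin; rewrite orthonormal_dot_proj.
Qed.

(** A vector already in the span adds nothing to the list, hence only an inequality between the
    sizes. *)
Lemma gram_schmidt (R : realType) (n : nat) (xs : seq 'cV[R]_n) :
  exists us : seq 'cV[R]_n, [/\ orthonormal us, (size us <= size xs)%N &
    forall x, x \in xs -> proj us x = x].
Proof.
elim: xs => [|x xs [us [ho hs hp]]]; first by exists [::].
pose z := x - proj us x.
have zus u : u \in us -> dot u z = 0.
  by move=> uin; rewrite dotBr orthonormal_dot_proj// subrr.
have [z0|z0] := eqVneq z 0.
  exists us; split=> //; first exact: ltnW.
  move=> y; rewrite in_cons => /predU1P[->|/hp//].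
  by apply/esym/eqP; rewrite -subr_eq0 -/z z0.
have zz : dot z z != 0 by rewrite dot_eq0.
have nz : l2norm z != 0.
  by apply: contraNneq zz => h; rewrite -sqr_l2norm h expr0n.
pose w := (l2norm z)^-1 *: z.
have wproj y : proj us y = y -> dot w y = 0.
  move=> <-; rewrite dotC dot_projl big_seq big1// => u uin.
  by rewrite dotZr zus// !mulr0.
exists (w :: us); split=> //.
- move: ho; rewrite /orthonormal/= => /andP[-> ->]; rewrite !andbT.
  rewrite dotZl dotZr -sqr_l2norm; apply/andP; split.
    by apply/eqP; field.
  by apply/allP => u uin; rewrite dotZl dotC zus// mulr0.
- move=> y; rewrite in_cons /proj big_cons -/(proj us y) => /predU1P[->|/hp yp].
    have -> : dot w x = l2norm z.
      have -> : x = z + proj us x by rewrite subrK.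
      by rewrite dotDr [X in _ + X]wproj ?orthonormal_proj_idem// addr0 dotZl
        -sqr_l2norm; field.
    by rewrite scalerA divff// scale1r subrK.
  by rewrite wproj// scale0r add0r.
Qed.

Lemma dot_mulmx_col (R : realType) (n p : nat) (X : 'M[R]_(n, p)) u v :
  dot u (X *m v) = \sum_j dot u (col j X) * v j 0.
Proof.
rewrite dot_mulmxr; apply: eq_bigr => j _; congr (_ * _).
by rewrite mxE; apply: eq_bigr => i _; rewrite !mxE mulrC.
Qed.

Lemma noisy_noiseless_le_proj (R : realType) (n p : nat) (X : 'M[R]_(n, p))
    (beta0 : 'cV[R]_p) (e : 'cV[R]_n) (lambda eta : R) (bh bs : 'cV[R]_p)
    (us : seq 'cV[R]_n) :
  0 < lambda -> 0 <= eta ->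
  noisy_lasso X (X *m beta0 + e) lambda bh ->
  noiseless_lasso X beta0 lambda bs ->
  (forall j, lambda * (1 - eta) <= `|(X^T *m (X *m (bs - beta0))) j 0| ->
    proj us (col j X) = col j X) ->
  (forall j, `|dot (e - proj us e) (col j X)| <= eta * lambda) ->
  l2norm (X *m (bh - bs)) <= l2norm (proj us e).
Proof.
move=> l0 eta0 hbh hbs hus hres; have lge0 := ltW l0.
move: hbs; rewrite noiseless_lassoE => hbs.
have rE : X^T *m (X *m (bs - beta0)) = - (X^T *m (X *m beta0 - X *m bs)).
  by rewrite -mulmxBr -mulmxN -mulmxN opprB.
set r := X^T *m (X *m (bs - beta0)) in rE hus.
have kkt_le j : `|r j 0| <= lambda by rewrite rE mxE normrN (lasso_kkt_le _ lge0 hbs).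
have kkt_eq j : lambda * `|bs j 0| = - (r j 0 * bs j 0).
  by rewrite rE mxE mulNr opprK (lasso_kkt_eq _ lge0 hbs).
apply: l2norm_le_of_dot; set d := bh - bs.
(* First-order condition of the noisy Lasso with the noiseless one as competitor; the residual is e
   - X (bs - beta0) - X d. *)
have h1 : dot (X *m d) (X *m d) <=
    dot e (X *m d) - dot r d + lambda * (l1norm bs - l1norm bh).
  have := lasso_first_order lge0 hbh bs.
  rewrite -(opprB bh bs) -/d mulmxN dotNr.
  have -> : X *m beta0 + e - X *m bh = e - X *m (bs - beta0) - X *m d.
    rewrite /d !mulmxBr; apply/matrixP => i k.
    by move: (X *m beta0) (X *m bh) (X *m bs) => x y z; rewrite !mxE; ring.
  by rewrite !dotBl [dot (X *m (bs - beta0)) _]dot_mulmxr -/r; lra.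
apply: le_trans h1 _; rewrite -[e in dot e _](subrK (proj us e)) dotDl.
rewrite -addrA -addrA [_ + (_ + _)]addrC -addrA gerDl.
rewrite dot_mulmx_col /dot -sumrN /l1norm -sumrB mulr_sumr -!big_split/=.
(* Once [proj us e] is split off, the rest is a sum over coordinates, and each summand is
   nonpositive. *)
apply: sumr_le0 => j _; rewrite -/(dot _ _).
have := kkt_eq j; have := kkt_le j; have := hres j.
have dE : d j 0 = bh j 0 - bs j 0 by rewrite !mxE.
(* On the active set [proj us] fixes the column, so the residual noise is orthogonal to it, and the
   two optimality conditions suffice. *)
have [hj|hj] := leP (lambda * (1 - eta)) `|r j 0|.
  rewrite dotBl [X in _ - X]dot_proj_comm hus// subrr mul0r => _ h2 h3.
  have : - (r j 0 * bh j 0) <= lambda * `|bh j 0|.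
    by rewrite (le_trans (ler_norm _))// normrN normrM ler_wpM2r.
  by rewrite dE; nra.
move=> h4 h2 h3.
(* Here |r_j| < lambda strictly, which is compatible with [kkt_eq] only if the coefficient is
   zero. *)
have bs0 : bs j 0 = 0.
  apply/eqP; rewrite -normr_eq0 eq_le normr_ge0 andbT.
  have : lambda * `|bs j 0| <= `|r j 0| * `|bs j 0|.
    by rewrite h3 -normrM -normrN ler_norm.
  rewrite -subr_ge0 -mulrBl nmulr_rge0//; nra.
rewrite dE bs0 subr0 normr0.
have h5 : dot (e - proj us e) (col j X) * bh j 0 <= eta * lambda * `|bh j 0|.
  by rewrite (le_trans (ler_norm _))// normrM ler_wpM2r.
have h6 : - (r j 0 * bh j 0) <= lambda * (1 - eta) * `|bh j 0|.
  by rewrite (le_trans (ler_norm _))// normrN normrM ler_wpM2r// ltW.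
lra.
Qed.

(** * Counting the active coordinates *)

Lemma mx_norm_ge (R : realType) (m k : nat) (A : 'M[R]_(m, k)) i j :
  `|A i j| <= mx_norm A.
Proof.
rewrite mx_normrE.
exact: (le_bigmax _ (fun ij : 'I_m * 'I_k => `|A ij.1 ij.2|) (i, j)).
Qed.

Lemma mulmx_le_mx_norm (R : realType) (m k : nat) (A : 'M[R]_(m, k)) h i :
  `|(A *m h) i 0| <= mx_norm A * l1norm h.
Proof.
rewrite mxE /l1norm mulr_sumr; apply: le_trans (ler_norm_sum _ _ _) _.
by apply: ler_sum => j _; rewrite normrM ler_wpM2r// mx_norm_ge.
Qed.

Lemma dot_le_bound_mul_l1norm (R : realType) (m : nat) (u v : 'cV[R]_m) c :
  (forall i, `|v i 0| <= c) -> dot u v <= c * l1norm u.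
Proof.
move=> hv; rewrite /dot /l1norm mulr_sumr; apply: ler_sum => i _.
by rewrite (le_trans (ler_norm _))// normrM mulrC ler_wpM2r.
Qed.

Lemma card_active_le (R : realType) (n p : nat) (X : 'M[R]_(n, p))
    (Sigma0 : 'M[R]_p) (h : 'cV[R]_p) (c : R) : (0 < p)%N -> psdmx Sigma0 ->
  let xi := mx_norm (gram X - Sigma0) * l1norm h in
  xi < c ->
  #|[set j | c <= `|(X^T *m (X *m h)) j 0|]%SET|%:R * (c - xi) ^+ 2 <=
  Lambda_max Sigma0 * (l2norm (X *m h) ^+ 2 + xi * l1norm h).
Proof.
move=> p0 psd xi xic.
(* The difference of the forms of [Sigma0] and [gram X] at h is at most xi |h|_1, by the max/l1
   bound applied twice. *)
have psd_quad : dot h (Sigma0 *m h) <= l2norm (X *m h) ^+ 2 + xi * l1norm h.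
  rewrite -lerBlDl sqr_l2norm.
  have -> : dot (X *m h) (X *m h) = dot h (gram X *m h).
    by rewrite /gram -mulmxA [RHS]dot_mulmxr trmxK.
  rewrite -dotBr -mulmxBl -opprB mulNmx; apply: dot_le_bound_mul_l1norm => i.
  by rewrite mxE normrN mulmx_le_mx_norm.
apply: le_trans (_ : dot (Sigma0 *m h) (Sigma0 *m h) <= _); last first.
  apply: le_trans (psd_sqr_mulmx_le_Lambda_max h p0 psd) _.
  rewrite ler_wpM2l//.
  exact: psd_Lambda_max_ge0.
(* Keep only the active coordinates of |Sigma0 h|^2; each contributes at least (c - xi)^2. *)
rewrite -sum1_card natr_sum mulr_suml /dot.
rewrite [leRHS](bigID (mem [set j | c <= `|(X^T *m (X *m h)) j 0|]%SET))/=.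
rewrite ler_wpDr ?sumr_ge0// => [i _|]; first by rewrite -expr2 sqr_ge0.
apply: ler_sum => j; rewrite inE mul1r -expr2 => hj.
rewrite -[leRHS]real_normK ?num_real// ler_sqr ?nnegrE ?subr_ge0 ?(ltW xic)//.
rewrite lerBlDr (le_trans hj)// mulmxA -/(gram X).
rewrite -[gram X](subrK Sigma0) mulmxDl mxE addrC.
by rewrite (le_trans (ler_normD _ _))// lerD2l mulmx_le_mx_norm.
Qed.

Lemma sqrt_div_le_of_mul_sqr_le (R : realType) (s a b n c : R) :
  0 <= s -> 0 < c -> 0 < n -> 0 <= b ->
  s * c ^+ 2 <= a * b ->
  Num.sqrt (s / n) <= Num.sqrt a * Num.sqrt b / (Num.sqrt n * c).
Proof.
move=> s0 c0 n0 b0 h.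
rewrite sqrtrM// sqrtrV ?(ltW n0)// invfM mulrA mulrAC.
rewrite ler_wpM2r ?invr_ge0 ?sqrtr_ge0// ler_pdivlMr//.
have cE : c = Num.sqrt (c ^+ 2) by rewrite sqrtr_sqr ger0_norm// ltW.
rewrite [c in leLHS]cE -(sqrtrM _ s0) [leRHS]mulrC -(sqrtrM _ b0) ler_wsqrtr//.
by rewrite [leRHS]mulrC.
Qed.

(** * Gaussian integrals and independence *)

Section weighted.
Context d d' (T : measurableType d) (T' : measurableType d') (R : realType).
Variables (mu : {measure set T -> \bar R}) (nu : {measure set T' -> \bar R}).
Variables (Z : T -> R) (X : T -> T').
Hypotheses (mZ : measurable_fun setT Z) (Z0 : forall t, 0 <= Z t).
Hypothesis mX : measurable_fun setT X.
Hypothesis ZX : forall B, measurable B ->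
  (\int[mu]_t (Z t * \1_B (X t))%:E)%E = nu B.
Import HBNNSimple.
Local Open Scope ereal_scope.

Lemma nnsfun_integral_weighted (h : {nnsfun T' >-> R}) :
  \int[mu]_t (Z t * h (X t))%:E = \int[nu]_x (h x)%:E.
Proof.
have mind y : measurable_fun setT (fun t => (Z t * \1_(h @^-1` [set y]) (X t))%:E).
  apply/measurable_EFinP; apply: measurable_funM => //.
  by apply: measurableT_comp => //; exact: measurable_indic.
rewrite integralT_nnsfun sintegralE.
transitivity (\int[mu]_t \sum_(y \in range h)
    (y%:E * (Z t * \1_(h @^-1` [set y]) (X t))%:E)).
  apply: eq_integral => t _; rewrite fimfunE EFinM -fsumEFin// ge0_mule_fsumr.
    by apply: eq_fsbigr => y _; rewrite !EFinM muleCA.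
  by move=> y; rewrite EFinM nnfun_muleindic_ge0.
have ge0 y t : 0 <= y%:E * (Z t * \1_(h @^-1` [set y]) (X t))%:E.
  rewrite EFinM muleCA; apply: mule_ge0; first by rewrite lee_fin.
  exact: nnfun_muleindic_ge0.
rewrite ge0_integral_fsum//.
  apply: eq_fsbigr => y; rewrite inE => -[z _ <-].
  rewrite ge0_integralZl// ?ZX ?lee_fin//.
  by move=> t _; rewrite lee_fin mulr_ge0.
by move=> y; apply: emeasurable_funM.
Qed.

(** [ZX] says that nu is the image under X of the measure with density Z; simple functions and
    monotone convergence pass from indicators to f. It is used with Z a normal density, with Z a
    product of independent factors, and with Z = 1 to change the copy of the Borel space. *)
Lemma ge0_integral_weighted (f : T' -> \bar R) :
  measurable_fun setT f -> (forall x, 0 <= f x) ->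
  \int[mu]_t ((Z t)%:E * f (X t)) = \int[nu]_x f x.
Proof.
move=> mf f0; pose f_ := nnsfun_approx measurableT mf.
transitivity (limn (fun n => \int[nu]_x (f_ n x)%:E)); last first.
  rewrite -monotone_convergence//.
  - apply: eq_integral => x _; apply/cvg_lim => //.
    exact: cvg_nnsfun_approx.
  - by move=> n; exact/measurable_EFinP.
  - by move=> n x _; rewrite lee_fin.
  - by move=> x _ a b ab; rewrite lee_fin//; exact/lefP/nd_nnsfun_approx.
transitivity (limn (fun n => \int[mu]_t (Z t * f_ n (X t))%:E)); last first.
  by congr (limn _); apply/funext => n; exact: nnsfun_integral_weighted.
rewrite -monotone_convergence//.
- apply: eq_integral => t _; apply/esym/cvg_lim => //.
  under eq_fun do rewrite EFinM.
  by apply: cvgeZl => //; exact: cvg_nnsfun_approx.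
- move=> n; apply/measurable_EFinP; apply: measurable_funM => //.
  by apply: measurableT_comp => //.
- by move=> n t _; rewrite lee_fin mulr_ge0.
- move=> t _ a b ab; rewrite lee_fin ler_wpM2l//; exact/lefP/nd_nnsfun_approx.
Qed.

End weighted.

(** * Exponential moments of the normal law *)

Section normal.
Context (R : realType).
Local Open Scope ereal_scope.
Notation leb := (@lebesgue_measure R).

Lemma ge0_integral_normal_prob (m s : R) (f : R -> \bar R) :
  measurable_fun setT f -> (forall x, 0 <= f x) ->
  \int[normal_prob m s]_x f x = \int[leb]_x ((normal_pdf m s x)%:E * f x).
Proof.
move=> mf f0; apply/esym; apply: (@ge0_integral_weighted _ _ _ _ _ leb _ _ id) => //.
- exact: measurable_normal_pdf.
- exact: normal_pdf_ge0.
- move=> B mB; rewrite /= /normal_prob [RHS]integral_mkcond.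
  apply: eq_integral => x _; rewrite patchE indicE; case: ifP => _ /=.
    by rewrite mulr1.
  by rewrite mulr0.
Qed.

(** Completing the square: the exponential tilt moves the mean to a s^2. *)
Lemma normal_pdf_expR (a s x : R) : s != 0%R ->
  (normal_pdf 0 s x * expR (a * x) =
   expR (a ^+ 2 * s ^+ 2 / 2) * normal_pdf (a * s ^+ 2) s x)%R.
Proof.
move=> s0; rewrite !normal_pdfE// -[LHS]mulrA [RHS]mulrCA; congr (_ * _)%R.
by rewrite /normal_fun -!expRD; congr expR; field.
Qed.

Lemma integral_expR_normal_prob (a s : R) : s != 0%R ->
  \int[normal_prob 0 s]_x (expR (a * x))%:E = (expR (a ^+ 2 * s ^+ 2 / 2))%:E.
Proof.
move=> s0; rewrite ge0_integral_normal_prob//; last first.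
  by apply/measurable_EFinP; apply: measurableT_comp => //; apply: measurable_funM.
transitivity (\int[leb]_x
    ((expR (a ^+ 2 * s ^+ 2 / 2))%:E * (normal_pdf (a * s ^+ 2) s x)%:E)).
  by apply: eq_integral => x _; rewrite -!EFinM normal_pdf_expR.
rewrite ge0_integralZl//; last 2 first.
  by apply/measurable_EFinP; exact: measurable_normal_pdf.
  by move=> x _; rewrite lee_fin normal_pdf_ge0.
by rewrite integral_normal_pdf mule1.
Qed.

(** The integrand times the standard density is c times the centred normal density of standard
    deviation c = (1 - t)^(-1/2). *)
Lemma integral_expR_sqr_normal_prob (t : R) : (0 <= t < 1)%R ->
  \int[normal_prob 0 1]_x (expR (t * x ^+ 2 / 2))%:E = ((Num.sqrt (1 - t))^-1)%:E.
Proof.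
move=> /andP[t0 t1]; set c := (Num.sqrt (1 - t))^-1%R.
have c0 : (0 < c)%R by rewrite invr_gt0 sqrtr_gt0 subr_gt0.
have c2 : (c ^+ 2 = (1 - t)^-1)%R.
  by rewrite exprVn sqr_sqrtr// subr_ge0 ltW.
rewrite ge0_integral_normal_prob//; last first.
  apply/measurable_EFinP; apply: measurableT_comp => //; apply: measurable_funM => //.
  by apply: measurable_funM => //; exact: measurable_funX.
transitivity (\int[leb]_x (c%:E * (normal_pdf 0 c x)%:E)).
  apply: eq_integral => x _; rewrite -!EFinM !normal_pdfE ?gt_eqF//; congr EFin.
  have -> : (normal_peak 1 = c * normal_peak c :> R)%R.
    rewrite /normal_peak -!mulrnAr expr1n mul1r sqrtrM ?sqr_ge0// sqrtr_sqr.
    by rewrite gtr0_norm// invfM mulrA divff ?gt_eqF// mul1r.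
  rewrite -!mulrA; congr (_ * (_ * _))%R; rewrite /normal_fun -!expRD.
  by congr expR; rewrite c2; field; rewrite subr_eq0 eq_sym lt_eqF.
rewrite ge0_integralZl//; last 3 first.
  by apply/measurable_EFinP; exact: measurable_normal_pdf.
  by move=> x _; rewrite lee_fin normal_pdf_ge0.
  by rewrite lee_fin ltW.
by rewrite integral_normal_pdf mule1.
Qed.

End normal.

(** * Expectation of a product of independent factors *)

Section independence.
Context d (T : measurableType d) (R : realType) (P : probability T R).
Local Open Scope ereal_scope.

(** Induction on [s], the indices whose factor need not be an indicator. With only indicators the
    claim is the product rule of independence; each step frees one factor by
    [ge0_integral_weighted], weighting with the product of the others. *)
Lemma mutually_independent_integral_prod (I : finType) (X : I -> {RV P >-> R})
    (s : seq I) (g : I -> R -> R) (m : I -> R) :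
  mutually_independent X ->
  (forall i, measurable_fun setT (g i)) -> (forall i x, 0 <= g i x)%R ->
  (forall i, \int[P]_w (g i (X i w))%:E = (m i)%:E) ->
  (forall i, i \notin s -> exists2 B, measurable B & g i = \1_B) ->
  \int[P]_w (\prod_i g i (X i w))%:E = (\prod_i m i)%:E.
Proof.
move=> hX; elim: s g m => [|i s IH] g m mg g0 gm gB.
  have {gB}[B mB gB] : exists2 B : I -> set R,
      forall i, measurable (B i) & forall i, g i = \1_(B i).
    have /choice[B hB] i : exists B, measurable B /\ g i = \1_B.
      by have [//|B mB gBE] := gB i; exists B.
    by exists B => i; case: (hB i).
  have PB i : P (X i @^-1` B i) = (m i)%:E.
    rewrite -gm gB -[RHS](_ : \int[P]_w (\1_(X i @^-1` B i) w)%:E = _)//.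
    by rewrite integral_indic ?setIT//; rewrite -[_ @^-1` _]setTI; exact: measurable_funP.
  have mX i : measurable (X i @^-1` B i).
    by rewrite -[_ @^-1` _]setTI; exact: measurable_funP.
  transitivity (P (\bigcap_(i in [set` [set: I]%SET]) (X i @^-1` B i))).
    rewrite -[in RHS](setIT (\bigcap_(_ in _) _)) -integral_indic//; last first.
      by apply: fin_bigcap_measurable => //; exact: finite_finset.
    apply: eq_integral => w _; congr EFin.
    rewrite [RHS]indicE; case: (boolP (w \in _)) => [|/negP hw] /=.
      rewrite inE => hw; apply: big1 => i _; rewrite gB indicE mem_set//.
      by apply: hw; rewrite /= inE.
    apply/eqP; rewrite prodf_seq_eq0; apply/hasP.
    apply: contra_notP hw => hw; rewrite inE => i _ /=.
    apply: contrapT => hi; apply: hw; exists i; first by rewrite mem_index_enum.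
    by rewrite /= gB indicE memNset.
  rewrite hX// (eq_bigr (fun i => (m i)%:E)) => [|i _]; last exact: PB.
  by rewrite prodEFin; congr EFin; apply: eq_bigl => i; rewrite inE.
have m0 j : (0 <= m j)%R.
  by rewrite -lee_fin -gm integral_ge0// => w _; rewrite lee_fin.
have mgX j : measurable_fun setT (g j \o X j) by apply: measurableT_comp.
pose c := (\prod_(j | j != i) m j)%R.
have c0 : (0 <= c)%R by apply: prodr_ge0.
rewrite (bigD1 i)//= -/c.
under eq_integral do rewrite (bigD1 i)//= mulrC EFinM.
rewrite (@ge0_integral_weighted _ _ _ _ _ P
  (mscale (NngNum c0) (distribution P (X i)))
  (fun w => \prod_(j | j != i) g j (X j w))%R (X i) _ _ _ _ (EFin \o g i))//.
- rewrite ge0_integral_mscale//; last 2 first.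
    exact/measurable_EFinP.
    by move=> x _; rewrite /= lee_fin.
  rewrite ge0_integral_distribution//; last 2 first.
    exact/measurable_EFinP.
    by move=> x; rewrite /= lee_fin.
  by rewrite gm -EFinM mulrC.
- under eq_fun do rewrite big_mkcond/=.
  by apply: measurable_prod => j _; case: (j != i) => //; exact: mgX.
- by move=> w; apply: prodr_ge0.
- move=> B mB; rewrite [RHS](_ : _ = c%:E * P (X i @^-1` B))//.
  have mXB : measurable (X i @^-1` B).
    by rewrite -[_ @^-1` _]setTI; exact: measurable_funP.
  have PE : P (X i @^-1` B) = (fine (P (X i @^-1` B)))%:E.
    by rewrite fineK// fin_num_measure.
  rewrite PE -EFinM mulrC.
  (* With the i-th factor replaced by the indicator of [B], the induction hypothesis for the shorter
     list applies. *)
  pose g' j := if j == i then \1_B else g j.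
  pose m' j := if j == i then fine (P (X i @^-1` B)) else m j.
  rewrite (_ : (_ * c)%R = \prod_j m' j)%R; last first.
    rewrite (bigD1 i)//= /m' eqxx; congr (_ * _)%R.
    by apply: eq_bigr => j /negbTE ->.
  rewrite -(IH g' m').
  + apply: eq_integral => w _; congr EFin.
    rewrite [RHS](bigD1 i)//= /g' eqxx mulrC; congr (_ * _)%R.
    by apply: eq_bigr => j /negbTE ->.
  + by move=> j; rewrite /g'; case: ifP => // _; exact: measurable_indic.
  + by move=> j x; rewrite /g'; case: ifP => // _; rewrite indicE.
  + move=> j; rewrite /g' /m'; case: eqVneq => [->|_]; last exact: gm.
    by rewrite -PE -[in RHS](setIT (X i @^-1` B)) -integral_indic.
  + move=> j js; rewrite /g'; case: eqVneq => [_|ji]; first by exists B.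
    by apply: gB; rewrite in_cons negb_or ji.
- exact/measurable_EFinP.
- by move=> x; rewrite /= lee_fin.
Qed.

End independence.

(** * Tail bounds for Gaussian vectors *)

Section gaussian_vector.
Context d (T : measurableType d) (R : realType) (P : probability T R) (n : nat).
Local Open Scope ereal_scope.

(* The law N(0, s2 I), through the Laplace transforms of its linear marginals. *)
Definition gaussian_mgf (xi : T -> 'cV[R]_n) (s2 : R) :=
  (forall v, measurable_fun setT (fun w => dot v (xi w))) /\
  forall v, \int[P]_w (expR (dot v (xi w)))%:E = (expR (s2 * dot v v / 2))%:E.

Lemma gaussian_mgf_independent (eps : 'I_n -> {RV P >-> R}) (s2 : R) :
  (0 < s2)%R -> mutually_independent eps ->
  (forall i, has_normal_law (eps i) 0 s2) ->
  gaussian_mgf (fun w => \col_i eps i w)%R s2.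
Proof.
move=> s20 heps hlaw; split=> v.
  rewrite /dot; under eq_fun do (under eq_bigr do rewrite mxE).
  by apply: measurable_sum => i; apply: measurable_funM.
have s0 : Num.sqrt s2 != 0%R by rewrite gt_eqF// sqrtr_gt0.
have mexp a : measurable_fun setT (fun x : R => expR (a * x)).
  by apply: measurableT_comp => //; apply: measurable_funM.
transitivity (\int[P]_w (\prod_i (fun i x => expR (v i 0 * x)) i (eps i w))%:E).
  apply: eq_integral => w _; rewrite -expR_sum; congr (expR _)%:E.
  by apply: eq_bigr => i _; rewrite mxE.
rewrite (@mutually_independent_integral_prod _ _ _ _ _ eps (index_enum 'I_n)
  (fun i x => expR (v i 0 * x))%R (fun i => expR (s2 * (v i 0 * v i 0) / 2))%R) => //.
- rewrite -expR_sum; congr (expR _)%:E.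
  by rewrite /dot mulr_sumr mulr_suml.
- move=> i; rewrite -(@ge0_integral_distribution _ _ _ _ _ P (eps i)
    (fun x => (expR (v i 0 * x)%R)%:E)); last 2 first.
    exact/measurable_EFinP.
    by move=> y; rewrite lee_fin expR_ge0.
  (* [normal_prob] and [distribution] live on two copies of the Borel space R
     with different displays, so [eq_measure_integral] does not apply. *)
  rewrite -(@ge0_integral_weighted _ _ _ _ _ (normal_prob 0 (Num.sqrt s2))
    (distribution P (eps i)) (cst 1%R) id)//; last 2 first.
  - move=> B mB; transitivity (normal_prob 0 (Num.sqrt s2) B); last first.
      exact/esym/hlaw.
    by under eq_integral do rewrite mul1r; rewrite integral_indic// setIT.
  - by apply/measurable_EFinP; exact: mexp.
  under eq_integral do rewrite mul1e.
  rewrite integral_expR_normal_prob// sqr_sqrtr ?ltW//.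
  by rewrite -expr2 [(s2 * _)%R]mulrC.
- by move=> i; rewrite mem_index_enum.
Qed.

(** Integrate exp(c) 1_{c <= Y} <= exp(Y). *)
Lemma exponential_markov (Y : T -> R) (c m : R) : measurable_fun setT Y ->
  \int[P]_w (expR (Y w))%:E <= (expR m)%:E ->
  P [set w | c <= Y w]%R <= (expR (m - c))%:E.
Proof.
move=> mY hY; pose A := [set w | c <= Y w]%R; rewrite -/A.
have mA : measurable A by rewrite -[A]setTI; exact: measurable_fun_le.
rewrite expRD expRN EFinM lee_pdivlMr ?expR_gt0//.
apply: le_trans hY; rewrite muleC -[A in P A]setIT -integral_indic//.
have mI : measurable_fun setT (fun w => (\1_A w : R)%:E).
  by apply/measurable_EFinP; exact: measurable_indic.
rewrite -ge0_integralZl//.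
apply: ge0_le_integral => //.
- by apply/measurable_EFinP; apply: measurable_funM => //; exact: measurable_indic.
- by apply/measurable_EFinP; exact: measurableT_comp.
move=> w _; rewrite -EFinM lee_fin indicE; case: (boolP (w \in A)) => /=.
  by rewrite inE mulr1 ler_expR.
by rewrite mulr0 expR_ge0.
Qed.

Lemma gaussian_tail (xi : T -> 'cV[R]_n) (s2 t : R) (v : 'cV[R]_n) :
  (0 < s2)%R -> (0 <= t)%R -> gaussian_mgf xi s2 -> (dot v v <= 1)%R ->
  P [set w | t <= `|dot v (xi w)|]%R <= (2 * expR (- (t ^+ 2 / (2 * s2))))%:E.
Proof.
move=> s20 t0 [mxi hxi] v1.
(* One-sided bound, stated so as to cover both v and -v; their union gives the factor 2. The
   exponent k = t / s2 minimizes s2 k^2 / 2 - k t. *)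
have half u : dot u u = dot v v ->
    P [set w | t <= dot u (xi w)]%R <= (expR (- (t ^+ 2 / (2 * s2))))%:E.
  move=> uu; pose k := (t / s2)%R.
  have k0 : (0 <= k)%R by rewrite divr_ge0// ltW.
  have := @exponential_markov (fun w => k * dot u (xi w))%R (k * t) (s2 * k ^+ 2 / 2).
  move=> /(_ _ _)/le_trans h.
  apply: (@le_trans _ _ (P [set w | k * t <= k * dot u (xi w)]%R)).
    apply: le_measure; rewrite ?inE.
    - by rewrite -[X in measurable X]setTI; apply: measurable_fun_le.
    - by rewrite -[X in measurable X]setTI; apply: measurable_fun_le => //;
        apply: measurable_funM.
    - by move=> w /=; exact: ler_wpM2l.
  apply: h; first exact: measurable_funM.
    under eq_integral do rewrite -dotZl.
    rewrite hxi lee_fin ler_expR dotZl dotZr uu ler_pM2r//.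
    by rewrite ler_pM2l// mulrA -expr2 ler_piMr// sqr_ge0.
  rewrite lee_fin ler_expR le_eqVlt; apply/orP; left; apply/eqP; rewrite /k.
  by field; rewrite gt_eqF.
have mset u : measurable [set w | t <= dot u (xi w)]%R.
  by rewrite -[X in measurable X]setTI; apply: measurable_fun_le.
apply: (@le_trans _ _ (P ([set w | t <= dot v (xi w)]%R `|`
                          [set w | t <= dot (- v) (xi w)]%R))).
  apply: le_measure; rewrite ?inE.
  - rewrite -[X in measurable X]setTI; apply: measurable_fun_le => //.
    exact: measurableT_comp.
  - exact: measurableU.
  - by move=> w /=; rewrite dotNl ler_normr => /orP.
apply: (le_trans (measureU2 _ (mset _) (mset _))).
rewrite mulrDl mul1r EFinD leeD//; apply: half => //.
by rewrite dotNl dotNr opprK.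
Qed.

(* The squares are linearized one at a time by exp (y^2 / 2) = E exp (g y) with g
   standard normal; integrating first over xi replaces v by v + k g u, which is
   still orthogonal to the remaining vectors. *)
Lemma gaussian_mgf_quadratic (xi : T -> 'cV[R]_n) (s2 k : R)
    (us : seq 'cV[R]_n) (v : 'cV[R]_n) :
  gaussian_mgf xi s2 -> (0 <= s2 * k ^+ 2 < 1)%R ->
  orthonormal us -> all (fun u => dot u v == 0)%R us ->
  \int[P]_w (expR (dot v (xi w) +
                   k ^+ 2 / 2 * \sum_(u <- us) dot u (xi w) ^+ 2)%R)%:E =
  (expR (s2 * dot v v / 2) * (Num.sqrt (1 - s2 * k ^+ 2))^-1 ^+ size us)%:E.
Proof.
move=> [mxi hxi] hk; elim: us v => [|u us IH] v.
  move=> _ _; rewrite expr0 mulr1 -hxi; apply: eq_integral => w _.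
  by rewrite big_nil mulr0 addr0.
rewrite /orthonormal/= => /andP[/andP[/eqP u1 us1] /andP[uus usus]].
move=> /andP[/eqP uv usv].
have ho : orthonormal us by rewrite /orthonormal us1.
pose F (z : T * R) : R := (expR (dot (v + (k * z.2) *: u) (xi z.1) +
                   k ^+ 2 / 2 * \sum_(u <- us) dot u (xi z.1) ^+ 2))%R.
have mF : measurable_fun setT (EFin \o F).
  apply/measurable_EFinP; apply: measurableT_comp => //.
  apply: measurable_funD.
    under eq_fun do rewrite dotDl dotZl.
    apply: measurable_funD.
      exact: (measurableT_comp (mxi v) measurable_fst).
    apply: measurable_funM; first by apply: measurable_funM.
    exact: (measurableT_comp (mxi u) measurable_fst).
  apply: measurable_funM => //; apply: measurable_sum => x.
  apply: measurable_funX; exact: (measurableT_comp (mxi x) measurable_fst).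
transitivity (\int[P]_w \int[normal_prob 0 1]_g (F (w, g))%:E).
  apply: eq_integral => w _; rewrite big_cons.
  pose c := expR (dot v (xi w) + k ^+ 2 / 2 * \sum_(u <- us) dot u (xi w) ^+ 2)%R.
  transitivity (\int[normal_prob 0 1]_g
      (c%:E * (expR (k * dot u (xi w) * g)%R)%:E)); last first.
    apply: eq_integral => g _; rewrite -EFinM /c /F/= -expRD dotDl dotZl.
    by congr (expR _)%:E; ring.
  rewrite ge0_integralZl ?lee_fin ?expR_ge0//; last first.
    by apply/measurable_EFinP; apply: measurableT_comp.
  rewrite integral_expR_normal_prob ?oner_eq0// -EFinM -expRD.
  by congr (expR _)%:E; rewrite expr1n; ring.
rewrite (@fubini_tonelli _ _ _ _ _ P (normal_prob 0 1) (EFin \o F))//; last first.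
  by move=> z; rewrite lee_fin expR_ge0.
(* By orthogonality of u and v the inner integral is c exp(s2 k^2 g^2 / 2); integrating over g
   yields the one further factor (1 - s2 k^2)^(-1/2). *)
pose c := (expR (s2 * dot v v / 2) * (Num.sqrt (1 - s2 * k ^+ 2))^-1 ^+ size us)%R.
transitivity (\int[normal_prob 0 1]_g
    (c%:E * (expR (s2 * k ^+ 2 * g ^+ 2 / 2)%R)%:E)).
  apply: eq_integral => g _; rewrite /F/= IH//; last first.
    apply/allP => x xus; rewrite dotDr dotZr (eqP (allP usv _ xus)) add0r.
    by rewrite dotC (eqP (allP uus _ xus)) mulr0.
  rewrite -EFinM /c [in RHS]mulrAC -expRD; congr (expR _ * _)%:E.
  by rewrite dotDl !dotDr !dotZl !dotZr (dotC v u) uv u1; field.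
have c0 : (0 <= c)%R.
  by rewrite mulr_ge0 ?expR_ge0// exprn_ge0// invr_ge0 sqrtr_ge0.
rewrite ge0_integralZl//; last first.
  apply/measurable_EFinP; apply: measurableT_comp => //.
  by apply: measurable_funM => //; apply: measurable_funM => //; exact: measurable_funX.
rewrite integral_expR_sqr_normal_prob// -EFinM /c; congr EFin.
by rewrite -[LHS]mulrA; congr (_ * _)%R; rewrite -exprSr.
Qed.

(** Chernoff bound for a chi-square variable. With a = sqrt s, b = sqrt (2 x) and r = a + b, the
    final exponent is a r - a^2 - (r^2 - a^2) / 2 = -(r - a)^2 / 2 = -x. *)
Lemma gaussian_chi2_tail (xi : T -> 'cV[R]_n) (s2 x : R) (s : nat)
    (us : seq 'cV[R]_n) :
  (0 < s2)%R -> (0 < x)%R -> gaussian_mgf xi s2 ->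
  orthonormal us -> (size us <= s)%N ->
  P [set w | Num.sqrt s2 * (Num.sqrt s%:R + Num.sqrt (2 * x)) <=
             Num.sqrt (\sum_(u <- us) dot u (xi w) ^+ 2)]%R <=
  (expR (- x))%:E.
Proof.
move=> s20 x0 hxi ho; have mxi := hxi.1.
have sx0 : (0 < Num.sqrt (2 * x))%R by rewrite sqrtr_gt0 mulr_gt0.
have sx2 : (Num.sqrt (2 * x) ^+ 2 = 2 * x)%R by rewrite sqr_sqrtr ?mulr_ge0// ltW.
have sw0 : (0 < Num.sqrt s2)%R by rewrite sqrtr_gt0.
have sw2 : (Num.sqrt s2 ^+ 2 = s2)%R by rewrite sqr_sqrtr// ltW.
move: sx0 sx2 sw0 sw2.
set sg := Num.sqrt s2; set b := Num.sqrt (2 * x) => b0 b2 sg0 sg2.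
(* For s = 0 the ratio r / a below would be meaningless; the list is empty and the event impossible
   because x > 0. *)
have [->|s0] := posnP s.
  rewrite leqn0 size_eq0 => /eqP ->.
  rewrite [X in P X](_ : _ = set0) ?measure0 ?lee_fin ?expR_ge0//.
  apply/seteqP; split=> // w /=; rewrite big_nil !sqrtr0 add0r.
  by rewrite leNgt mulr_gt0.
move=> szus; set a := Num.sqrt s%:R.
have a0 : (0 < a)%R by rewrite sqrtr_gt0 ltr0n.
have a2 : (a ^+ 2 = s%:R)%R by rewrite sqr_sqrtr// ler0n.
pose r := (a + b)%R; have r0 : (0 < r)%R by rewrite addr_gt0.
pose Q w := (\sum_(u <- us) dot u (xi w) ^+ 2)%R.
have Q0 w : (0 <= Q w)%R by apply: sumr_ge0 => u _; rewrite sqr_ge0.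
(* The optimal exponent in the Chernoff bound. *)
pose t := (1 - a ^+ 2 / r ^+ 2)%R.
have t0 : (0 <= t)%R.
  rewrite subr_ge0 ler_pdivrMr ?exprn_gt0// mul1r ler_pXn2r ?nnegrE ?ltW//.
  by rewrite /r ltrDl.
have t1 : (t < 1)%R by rewrite /t gtrBl divr_gt0 ?exprn_gt0.
pose k := Num.sqrt (t / s2).
have k2 : (s2 * k ^+ 2 = t)%R.
  rewrite sqr_sqrtr ?divr_ge0 ?(ltW s20)// mulrC divfK// gt_eqF//.
have := @gaussian_mgf_quadratic xi s2 k us 0 hxi.
rewrite k2 t0 t1 => /(_ isT ho); rewrite dot0r mulr0 mul0r expR0 mul1r.
have -> : all (fun u => dot u 0 == 0)%R us.
  by apply/allP => u _; rewrite dot0r.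
move=> /(_ isT).
have -> : Num.sqrt (1 - t) = (a / r)%R.
  rewrite /t opprB addrC subrK -expr_div_n sqrtr_sqr ger0_norm//.
  by rewrite divr_ge0// ltW.
rewrite invf_div => hint.
have mQ : measurable_fun setT Q.
  by apply: measurable_sum => u; apply: measurable_funX.
(* The moment is (r / a)^(size us) <= (r / a)^s, as r >= a, and r / a <= exp(r / a - 1). *)
have hQ : \int[P]_w (expR (k ^+ 2 / 2 * Q w)%R)%:E <= (expR (a * r - a ^+ 2)%R)%:E.
  under eq_integral => w _ do rewrite -[(_ * Q w)%R]add0r -[in X in (X + _)%R](dot0l (xi w)).
  rewrite hint lee_fin.
  apply: (@le_trans _ _ ((r / a) ^+ s)%R).
    by rewrite ler_weXn2l// ler_pdivlMr// mul1r /r lerDl ltW.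
  apply: (@le_trans _ _ (expR (r / a - 1) ^+ s)%R).
    rewrite lerXn2r ?nnegrE ?expR_ge0 ?divr_ge0 ?(ltW r0) ?(ltW a0)//.
    by have := expR_ge1Dx (r / a - 1)%R; rewrite addrC subrK.
  rewrite -expRM_natl -a2 le_eqVlt; apply/orP; left; apply/eqP; congr expR.
  by field; rewrite gt_eqF.
have mkQ : measurable_fun setT (fun w => k ^+ 2 / 2 * Q w)%R.
  exact: measurable_funM.
apply: (@le_trans _ _ (P [set w | k ^+ 2 / 2 * (s2 * r ^+ 2) <= k ^+ 2 / 2 * Q w]%R)).
  apply: le_measure; rewrite ?inE.
  - rewrite -[X in measurable X]setTI; apply: measurable_fun_le => //.
    apply: (measurableT_comp _ mQ).
    exact: continuous_measurable_fun (@sqrt_continuous R).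
  - by rewrite -[X in measurable X]setTI; apply: measurable_fun_le.
  - move=> w /= h; rewrite ler_wpM2l ?divr_ge0 ?sqr_ge0//.
    rewrite -sg2 -exprMn -(sqr_sqrtr (Q0 w)) lerXn2r ?nnegrE ?sqrtr_ge0//.
    by rewrite mulr_ge0// ltW.
apply: le_trans (exponential_markov _ mkQ hQ) _; rewrite lee_fin ler_expR.
have -> : (k ^+ 2 / 2 * (s2 * r ^+ 2) = t * r ^+ 2 / 2)%R by rewrite -k2; ring.
have -> : (t * r ^+ 2 = r ^+ 2 - a ^+ 2)%R.
  by rewrite /t mulrBl mul1r divfK// expf_neq0// gt_eqF.
have xE : (x = b ^+ 2 / 2)%R by rewrite b2; field.
by rewrite xE le_eqVlt; apply/orP; left; apply/eqP; rewrite /r; field.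
Qed.

End gaussian_vector.

(** * Measurability and conclusion *)

Lemma l2normD (R : realType) (m : nat) (u v : 'cV[R]_m) :
  l2norm (u + v) <= l2norm u + l2norm v.
Proof.
rewrite -ler_sqr ?nnegrE ?addr_ge0 ?l2norm_ge0// sqrrD !sqr_l2norm.
rewrite dotDl !dotDr (dotC v u).
by have := dot_le_l2norm u v; rewrite -mulr_natl; lra.
Qed.

Lemma l2norm_le_l1norm (R : realType) (m : nat) (u : 'cV[R]_m) :
  l2norm u <= l1norm u.
Proof.
have l1_ge0 : 0 <= l1norm u by apply: sumr_ge0.
rewrite -ler_sqr ?nnegrE ?l2norm_ge0// sqr_l2norm expr2.
apply: dot_le_bound_mul_l1norm => i; rewrite /l1norm (bigD1 i)//= lerDl.
exact: sumr_ge0.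
Qed.

Lemma l1normN (R : realType) (m : nat) (u : 'cV[R]_m) : l1norm (- u) = l1norm u.
Proof. by apply: eq_bigr => i _; rewrite mxE normrN. Qed.

Lemma l1normD (R : realType) (m : nat) (u v : 'cV[R]_m) :
  l1norm (u + v) <= l1norm u + l1norm v.
Proof.
by rewrite /l1norm -big_split; apply: ler_sum => i _; rewrite mxE ler_normD.
Qed.

Lemma rat_dense_l1norm (R : realType) (m : nat) (x : 'cV[R]_m) (e : R) : 0 < e ->
  exists q : 'cV[rat]_m, l1norm (map_mx ratr q - x) <= e.
Proof.
move=> e0; pose d := e / m.+1%:R.
have d0 : 0 < d by rewrite divr_gt0.
have /choice[q hq] i : exists q : rat, `|ratr q - x i 0| <= d.
  have [|q] := @rat_in_itvoo R (x i 0) (x i 0 + d); first by rewrite ltrDl.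
  rewrite in_itv/= => /andP[h1 h2]; exists q.
  by rewrite ger0_norm ?subr_ge0 ?ltW// ltrBlDl.
exists (\col_i q i); apply: (@le_trans _ _ (\sum_(i < m) d)).
  by apply: ler_sum => i _; rewrite !mxE.
rewrite sumr_const card_ord -mulr_natr /d -mulrA ler_piMr ?(ltW e0)//.
by rewrite mulrC ler_pdivrMr// mul1r ler_nat.
Qed.

(* A sublevel set of a Lipschitz function of xi is the preimage under xi of a
   relatively closed set, written here with countably many rational balls. *)
Lemma measurable_lipschitz_sublevel (R : realType) (n : nat)
    (d : measure_display) (T : measurableType d) (xi : T -> 'cV[R]_n)
    (f : T -> R) (c : R) :
  (forall i, measurable_fun setT (fun w => xi w i 0)) ->
  (forall w w', f w <= f w' + l1norm (xi w - xi w')) ->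
  measurable [set w | f w <= c].
Proof.
move=> mxi hf.
pose B (k : nat) (q : 'cV[rat]_n) :=
  [set w | l1norm (map_mx ratr q - xi w) <= k.+1%:R^-1].
have mB k q : measurable (B k q).
  rewrite -[B k q]setTI; apply: measurable_fun_le => //.
  apply: measurable_sum => i; apply: measurableT_comp => //.
  by under eq_fun do rewrite !mxE; apply: measurable_funB.
(* [F k q] is either all of [B k q] or empty, hence measurable although f is not assumed to be. *)
pose F k q := [set w | (exists2 w', f w' <= c & B k q w') /\ B k q w].
have mF k q : measurable (F k q).
  have [h|h] := pselect (exists2 w', f w' <= c & B k q w').
    by rewrite (_ : F k q = B k q)//; apply/seteqP; split=> [w []|w].
  by rewrite (_ : F k q = set0)//; apply/seteqP; split=> [w []|w].
rewrite (_ : [set w | f w <= c] = \bigcap_k \bigcup_q F k q).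
  apply: bigcapT_measurable => k.
  by apply: countable_bigcupT_measurable => //; exact: countableP.
apply/seteqP; split=> w /= hw.
  move=> k _; have [q hq] := @rat_dense_l1norm R n (xi w) k.+1%:R^-1 ltac:(by []).
  by exists q => //; split=> //; exists w.
(* A ball of radius 1/(k+1) holding both xi w and some xi w' with f w' <= c forces f w <= c +
   2/(k+1), which fails for large k. *)
rewrite leNgt; apply/negP => fwc.
have [k _ hk] : exists2 k, True & 2 * k.+1%:R^-1 < f w - c.
  have e0 : 0 < (f w - c) / 2 by rewrite divr_gt0// subr_gt0.
  have [k hk] := ltr_add_invr e0.
  by exists k => //; rewrite mulrC -ltr_pdivlMr//; rewrite add0r in hk.
have [q _ [[w' fw' Bw'] Bw]] := hw k I.
have := hf w w'; have : l1norm (xi w - xi w') <= 2 * k.+1%:R^-1.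
  rewrite (_ : xi w - xi w' =
      - (map_mx ratr q - xi w) + (map_mx ratr q - xi w')).
    rewrite (le_trans (l1normD _ _))// l1normN mulrDl mul1r lerD//.
  by rewrite opprB addrA subrK.
move=> h1 h2; have := le_trans h2 (lerD fw' h1).
by rewrite leNgt -ltrBrDl hk.
Qed.

Lemma measure_bigsetU_le (R : realType) (d : measure_display)
    (T : measurableType d) (P : {measure set T -> \bar R}) (I : Type)
    (s : seq I) (A : I -> set T) :
  (forall i, measurable (A i)) ->
  (P (\big[setU/set0]_(i <- s) A i) <= \sum_(i <- s) P (A i))%E.
Proof.
move=> mA; elim: s => [|i s IH]; first by rewrite !big_nil measure0.
rewrite !big_cons; apply: le_trans (measureU2 _ _ _) _ => //.
  by apply: bigsetU_measurable.
exact: leeD.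
Qed.

Theorem theorem2p2 (R : realType) (n p : nat) (hn : (0 < n)%N) (hp : (0 < p)%N)
    (X : 'M[R]_(n, p)) (hX : forall j : 'I_p, l2norm (col j X) <= 1)
    (beta0 : 'cV[R]_p)
    (d : measure_display) (T : measurableType d) (P : probability T R)
    (eps : 'I_n -> {RV P >-> R})
    (eps_indep : mutually_independent eps)
    (eps_normal : forall i : 'I_n, has_normal_law (eps i) 0 (n%:R)^-1)
    (alpha alpha1 : R)
    (halpha : 0 < alpha < 1) (halpha1 : 0 < alpha1 < 1)
    (eta lambda : R) (heta : 0 <= eta < 1)
    (hlambda : Num.sqrt (2 * ln (2 * p%:R / alpha) / n%:R) < eta * lambda)
    (betahat : T -> 'cV[R]_p)
    (hbetahat : forall w : T,
      noisy_lasso X (X *m beta0 + \col_i eps i w) lambda (betahat w))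
    (betastar : 'cV[R]_p)
    (hbetastar : noiseless_lasso X beta0 lambda betastar)
    (Sigma0 : 'M[R]_p) (hSigma0 : psdmx Sigma0) :
  let xi := mx_norm (gram X - Sigma0) * l1norm (betastar - beta0) in
  xi < lambda * (1 - eta) ->
  let E := [set w : T |
    l2norm (X *m (betahat w - betastar)) <=
      Num.sqrt (Lambda_max Sigma0) *
      Num.sqrt (l2norm (X *m (betastar - beta0)) ^+ 2 +
                xi * l1norm (betastar - beta0)) /
      (Num.sqrt n%:R * (lambda * (1 - eta) - xi)) +
      Num.sqrt (2 * ln (alpha1^-1) / n%:R)] in
  measurable E /\ ((1 - alpha - alpha1)%:E <= P E)%E.
Proof.
move=> xi hxi E.
have [eta0 eta1] := andP heta; have [al0 al1] := andP halpha.
have [be0 be1] := andP halpha1.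
have el0 : 0 < eta * lambda by apply: le_lt_trans hlambda; exact: sqrtr_ge0.
have l0 : 0 < lambda.
  by rewrite ltNge; apply/negP => l0; have := mulr_ge0_le0 eta0 l0; rewrite leNgt el0.
have n0 : 0 < n%:R :> R by rewrite ltr0n.
have s20 : 0 < (n%:R^-1 : R) by rewrite invr_gt0.
pose e w : 'cV[R]_n := \col_i eps i w.
have he : gaussian_mgf P e n%:R^-1 by exact: gaussian_mgf_independent.
(* [betahat] is an arbitrary selection of minimizers; measurability comes from the Lipschitz
   dependence of its fit on the noise. *)
have mE : measurable E.
  apply: (@measurable_lipschitz_sublevel _ _ _ _ e).
    by move=> i; under eq_fun do rewrite mxE; exact: measurable_funP.
  move=> w w'.
  have -> : betahat w - betastar = (betahat w' - betastar) + (betahat w - betahat w').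
    by rewrite [RHS]addrC addrA subrK.
  rewrite mulmxDr; apply: le_trans (l2normD _ _) _; rewrite lerD2l.
  apply: le_trans (l2norm_le_l1norm _).
  have := lasso_lipschitz (ltW l0) (hbetahat w) (hbetahat w').
  by rewrite opprD addrACA subrr add0r.
split=> //.
pose S := [set j | lambda * (1 - eta) <= `|(X^T *m (X *m (betastar - beta0))) j 0|]%SET.
have [us [ho hs hus]] := gram_schmidt [seq col j X | j <- enum S].
rewrite size_map -cardE in hs.
have xi0 : 0 <= xi.
  apply: mulr_ge0; last by apply: sumr_ge0.
  by apply: le_trans (mx_norm_ge _ (Ordinal hp) (Ordinal hp)).
pose x := ln alpha1^-1.
have x0 : 0 < x by rewrite ln_gt0// invf_gt1.
pose lambda0 := Num.sqrt (2 * ln (2 * p%:R / alpha) / n%:R).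
have p1 : 1 <= p%:R :> R by rewrite ler1n.
have q1 : 1 < 2 * p%:R / alpha by rewrite ltr_pdivlMr// mul1r; lra.
(* The bad events: [A j] is a large correlation of column j with the noise off the active span, [B]
   a large noise component inside that span. *)
pose A j := [set w | lambda0 <= `|dot (col j X - proj us (col j X)) (e w)|].
pose B := [set w | Num.sqrt n%:R^-1 * (Num.sqrt #|S|%:R + Num.sqrt (2 * x)) <=
                   Num.sqrt (\sum_(u <- us) dot u (e w) ^+ 2)].
have mA j : measurable (A j).
  rewrite -[A j]setTI; apply: measurable_fun_le => //.
  by apply: measurableT_comp => //; exact: he.1.
have mB : measurable B.
  rewrite -[B]setTI; apply: measurable_fun_le => //.
  apply: (measurableT_comp (continuous_measurable_fun (@sqrt_continuous R))).
  by apply: measurable_sum => u; apply: measurable_funX; exact: he.1.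
(* Projecting out the active span does not lengthen a column, so its norm stays at most 1, and
   lambda0 is chosen so that the tail is 2 alpha / (2 p). *)
have PA j : (P (A j) <= (alpha / p%:R)%:E)%E.
  apply: le_trans (gaussian_tail s20 (sqrtr_ge0 _) he _) _.
    rewrite dotBl !dotBr (dotC (col j X) (proj _ _)).
    rewrite [dot (proj us (col j X)) (proj us (col j X))]dot_proj_comm.
    rewrite orthonormal_proj_idem// (dotC (col j X) (proj _ _)) subrr subr0.
    apply: (@le_trans _ _ (dot (col j X) (col j X))).
      rewrite gerBl dot_projl; apply: sumr_ge0 => u _.
      by rewrite -expr2 sqr_ge0.
    by rewrite -sqr_l2norm expr_le1// l2norm_ge0.
  rewrite lee_fin sqr_sqrtr; last first.
    by rewrite divr_ge0 ?ler0n// mulr_ge0// ln_ge0// ltW.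
  rewrite (_ : 2 * ln _ / n%:R / (2 / n%:R) = ln (2 * p%:R / alpha)); last first.
    by field; rewrite gt_eqF.
  rewrite expRN lnK ?posrE ?(lt_trans ltr01 q1)// le_eqVlt.
  by apply/orP; left; apply/eqP; field; rewrite !gt_eqF// (lt_le_trans ltr01 p1).
have PB : (P B <= alpha1%:E)%E.
  apply: le_trans (gaussian_chi2_tail s20 x0 he ho hs) _.
  by rewrite lee_fin /x lnV ?posrE// opprK lnK.
pose bad := (\big[setU/set0]_j A j) `|` B.
have mAs : measurable (\big[setU/set0]_j A j) by exact: bigsetU_measurable.
have mbad : measurable bad by exact: measurableU.
have Pbad : (P bad <= (alpha + alpha1)%:E)%E.
  apply: le_trans (measureU2 _ mAs mB) _; rewrite EFinD leeD//.
  apply: le_trans (measure_bigsetU_le _ _ mA) _.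
  apply: (@le_trans _ _ (\sum_(j < p) (alpha / p%:R)%:E)%E); first by apply: lee_sum => j _; exact: PA.
  rewrite sumEFin lee_fin sumr_const card_ord -[_ *+ p]mulr_natr divfK//.
  by rewrite gt_eqF// (lt_le_trans ltr01 p1).
apply: (@le_trans _ _ (P (~` bad))).
  rewrite probability_setC// leeBrDr; last by rewrite fin_num_measure.
  by rewrite -addrA -opprD; apply: le_trans (leeD2l _ Pbad) _; rewrite -EFinD subrK.
apply: le_measure; rewrite ?inE//; first exact: measurableC.
move=> w hw; rewrite /E/=.
have hA j : ~ A j w.
  by move=> h; apply: hw; left; rewrite -bigcup_seq; exists j => //=; rewrite mem_index_enum.
have hB : ~ B w by move=> h; apply: hw; right.
(* Off the bad events the deterministic comparison applies; then [B] bounds the projected noise and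
   [card_active_le] bounds #|S|. *)
apply: le_trans (noisy_noiseless_le_proj (us := us) l0 eta0 (hbetahat w) hbetastar _ _) _.
- move=> j hj; apply: hus; apply/mapP; exists j => //.
  by rewrite mem_enum inE.
- move=> j; have /negP := hA j; rewrite -ltNge => /ltW h.
  apply: le_trans (le_trans h (ltW hlambda)).
  by rewrite !dotBl dot_proj_comm (dotC (col j X)) (dotC (proj us (col j X))).
have -> : l2norm (proj us (e w)) = Num.sqrt (\sum_(u <- us) dot u (e w) ^+ 2).
  rewrite -[LHS]ger0_norm ?l2norm_ge0// -sqrtr_sqr sqr_l2norm.
  rewrite dot_proj_comm orthonormal_proj_idem// dotC dot_projl.
  by congr Num.sqrt; apply: eq_bigr => u _; rewrite expr2.
have /negP := hB; rewrite -ltNge => /ltW h; apply: le_trans h _.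
rewrite mulrDr -!(sqrtrM _ (ltW s20)) !(mulrC n%:R^-1) lerD2r.
apply: sqrt_div_le_of_mul_sqr_le => //; first by rewrite subr_gt0.
  by rewrite addr_ge0 ?sqr_ge0// mulr_ge0// sumr_ge0.
exact: card_active_le.
Qed.
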